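(* Let $S$ be a Damek--Ricci space in the half-space model. If $\hat\eta$ is a geodesic curve in $S$ with prolongation $\eta$, then for each point $p$ of $\hat\eta$ there is a unique focal variety of the form $\mathcal F_{x_0}$ (with $x_0\in\mathfrak v\oplus\mathfrak z\oplus\mathbb R$ having negative last coordinate) or $\mathcal F_{\circledast}^{\eta}$ that meets $\hat\eta$ orthogonally at $p$.
   Context: Damek--Ricci space: let $\mathfrak s=\mathfrak v\oplus\mathfrak z\oplus\mathfrak a$ be an orthogonal decomposition of a finite-dimensional Euclidean space $(\mathfrak s,\langle\,,\rangle)$ with $\mathfrak a=\mathbb RA$, $\|A\|=1$, $n=\dim\mathfrak v$, $m=\dim\mathfrak z$ (either may be $0$). Let $J$ be a representation on $\mathfrak v$ of the Clifford algebra $\mathrm{Cl}(\mathfrak z,q)$ of $q(Z)=-\langle Z,Z\rangle$ with $\|J_ZV\|=\|Z\|\|V\|$. The Lie bracket on $\mathfrak s$ is determined by $\langle[U,V],Z\rangle=\langle J_ZU,V\rangle$ with $[U,V]\in\mathfrak z$ for $U,V\in\mathfrak v$, $Z\in\mathfrak z$; $[\mathfrak v\oplus\mathfrak z,\mathfrak z]=0$; $[A,V]=\frac12V$ for $V\in\mathfrak v$; $[A,Z]=Z$ for $Z\in\mathfrak z$. The simply connected Lie group $S$ with Lie algebra $\mathfrak s$ and the left-invariant metric induced by $\langle\,,\rangle$ is the Damek--Ricci space. Half-space model: $S$ is identified with $\mathfrak v\oplus\mathfrak z\times\mathbb R_+\subset\mathfrak v\oplus\mathfrak z\oplus\mathbb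 R\cong\mathfrak s$ via $(V,Z,t)\mapsto\exp(V+Z)\exp((\ln t)A)$; $e=(0,0,1)$; $(v,z,s)\in T_eS$ means $v+z+sA$. The left translation by $(\bar V,\bar Z,\bar t)\in S$ extends to the affine map $L_{(\bar V,\bar Z,\bar t)}(V,Z,t)=(\bar V+\sqrt{\bar t}V,\ \bar Z+\bar tZ+\frac12\sqrt{\bar t}[\bar V,V],\ \bar tt)$ of $\mathfrak v\oplus\mathfrak z\oplus\mathbb R$ and to the projective closure $\mathbf P(\mathfrak s\oplus\mathbb R)$ of $\mathfrak s$. Prolongation: for a unit vector $(v,z,s)\in T_eS$ the unit speed geodesic from $e$ with this initial velocity is $\hat\gamma(t)=\gamma(\tanh(t/2))$, where $\gamma(\theta)=\left(\frac{2\theta(1-s\theta)}{\chi(\theta)}v+\frac{2\theta^2}{\chi(\theta)}J_zv,\frac{2\theta}{\chi(\theta)}z,\frac{1-\theta^2}{\chi(\theta)}\right)$, $\chi(\theta)=(1-s\theta)^2+\|z\|^2\theta^2$; its prolongation is the continuous extension $\gamma\colon\mathbb R\mathbf P^1\to\mathbf P(\mathfrak s\oplus\mathbb R)$. A general unit speed geodesic is $\hat\eta=L_p\circ\hat\gamma$ for unique $p\in S$ and $(v,z,s)$; its prolongation is $\eta=L_p\circ\gamma$, so $\hat\eta(t)=\eta(\tanh(t/2))$. Focal varieties $\mathcal F_{x_0}$: for $x_0=(V_0,Z_0,t_0)$ let $D_{x_0}((V,Z,t))=\frac1t\left(\left(t+t_0+\left\|\frac{V-V_0}{2}\right\|^2\right)^2+\left\|Z-Z_0+\frac12[V,V_0]\right\|^2\right)$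 on $S$. For $t_0<0$ the minimum of $D_{x_0}$ is $0$, and $\mathcal F_{x_0}=D_{x_0}^{-1}(0)=\{(V,Z,t)\in S:\|V-V_0\|^2=-4(t+t_0),\ Z=Z_0-\frac12[V,V_0]\}$. Focal variety $\mathcal F_{\circledast}^{\eta}$: defined only when $\eta=L_{(\bar V,\bar Z,\bar t)}\circ\gamma$ with $\gamma$ of unit initial velocity $(v,0,s)$ (i.e. $z=0$). If $v\neq0$, then $\mathcal F_{\circledast}^{\eta}=\{(V,Z,t)\in S:[V-\bar V,v]=0,\ \langle V-\bar V,v\rangle=2s\sqrt{\bar t}\}$; if $v=0$, it is empty. When $z\neq0$, only the focal varieties $\mathcal F_{x_0}$ are considered. *)

(* Defs.v *)
From HB Require Import structures.
From mathcomp Require Import all_boot all_order all_algebra.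
From mathcomp Require Import all_classical all_reals all_analysis.
From mathcomp Require Import lra.
Import Order.TTheory GRing.Theory Num.Theory.
Import numFieldNormedType.Exports.

Set Implicit Arguments.
Unset Strict Implicit.
Unset Printing Implicit Defensive.

Local Open Scope classical_set_scope.
Local Open Scope ring_scope.

(* Euclidean structure of R^k; the norm `| x | that MathComp-Analysis puts on
   'rV_k is the sup norm, hence enorm.  *)
Definition dot (R : realType) (k : nat) (x y : 'rV[R]_k) : R :=
  \sum_(i < k) x 0 i * y 0 i.

Definition enorm (R : realType) (k : nat) (x : 'rV[R]_k) : R :=
  Num.sqrt (dot x x).

Definition tanh (R : realType) (x : R) : R :=
  (expR x - expR (- x)) / (expR x + expR (- x)).

(* v = R^n, z = R^m, a = R A; the triple (V, Z, t) stands for V + Z + t A.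
   The same type serves as the ambient space v + z + R of the half-space model
   and as its tangent space at each point.  *)
Notation amb R n m := ('rV[R]_n * 'rV[R]_m * R)%type.

Section Dot.
Context {R : realType} {k : nat}.
Implicit Types x y z : 'rV[R]_k.

Lemma dotC x y : dot x y = dot y x.
Proof. by apply: eq_bigr => i _; rewrite mulrC. Qed.

Lemma dotDl x y z : dot (x + y) z = dot x z + dot y z.
Proof. by rewrite /dot -big_split; apply: eq_bigr => i _; rewrite mxE mulrDl. Qed.

Lemma dotZl a x y : dot (a *: x) y = a * dot x y.
Proof. by rewrite /dot mulr_sumr; apply: eq_bigr => i _; rewrite mxE mulrA. Qed.

Lemma dot_ge0 x : 0 <= dot x x.
Proof. by apply: sumr_ge0 => i _; rewrite -expr2 sqr_ge0. Qed.

Lemma dot_eq0 x : dot x x = 0 -> x = 0.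
Proof.
move=> /eqP; rewrite psumr_eq0 => [/allP x0|i _]; last by rewrite -expr2 sqr_ge0.
apply/rowP => i; rewrite mxE; apply/eqP.
by have := x0 i (mem_index_enum i); rewrite mulf_eq0 orbb.
Qed.

Lemma enorm_sqr x : enorm x ^+ 2 = dot x x.
Proof. by rewrite sqr_sqrtr ?dot_ge0. Qed.

End Dot.

Section DamekRicci.
Context {R : realType} {n m : nat}.
Local Notation E := (amb R n m).

Definition ip (X Y : E) : R :=
  dot X.1.1 Y.1.1 + dot X.1.2 Y.1.2 + X.2 * Y.2.

(* The half-space model of S: (V, Z, t) is exp (V + Z) exp (ln t A).  *)
Definition halfspace : set E := [set p | 0 < p.2].

(* J Z acts on row vectors: J_Z V is V *m J Z.  By the universal property of
   Cl(z, q), a representation of it on v is a linear map J : z -> End(v) with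
   J_Z^2 = q(Z) Id, where q(Z) = - <Z, Z>.  *)
Definition clifford_rep (J : {linear 'rV[R]_m -> 'M[R]_n}) : Prop :=
  (forall Z, J Z *m J Z = (- dot Z Z)%:M) /\
  (forall Z V, enorm (V *m J Z) = enorm Z * enorm V).

Section Geometry.
Variable J : {linear 'rV[R]_m -> 'M[R]_n}.

(* The restriction to v of the Lie bracket; bracketP is its defining property.
   The other brackets of s enter only through the group law ltrans.  *)
Definition bracket (U V : 'rV[R]_n) : 'rV[R]_m :=
  \row_i dot (U *m J (delta_mx 0 i)) V.

Lemma bracketP (U V : 'rV[R]_n) (Z : 'rV[R]_m) :
  dot (bracket U V) Z = dot (U *m J Z) V.
Proof.
rewrite {2}(row_sum_delta Z) linear_sum mulmx_sumr /dot.
under [RHS]eq_bigr => j _ do rewrite summxE mulr_suml.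
rewrite exchange_big /=; apply: eq_bigr => i _.
rewrite mxE /dot mulr_suml; apply: eq_bigr => j _.
by rewrite linearZ -scalemxAr [in RHS]mxE mulrAC [RHS]mulrAC [RHS]mulrC mulrA.
Qed.

Lemma dot_skew (V : 'rV[R]_n) (Z : 'rV[R]_m) :
  clifford_rep J -> dot (V *m J Z) V = 0.
Proof.
move=> [J2 Jnorm]; have Jdot W : dot (W *m J Z) (W *m J Z) = dot Z Z * dot W W.
  by rewrite -!enorm_sqr Jnorm exprMn.
have [Z0|ZN0] := eqVneq (dot Z Z) 0.
  have /dot_eq0 -> : dot (V *m J Z) (V *m J Z) = 0 by rewrite Jdot Z0 mul0r.
  by rewrite -(scale0r 0) dotZl mul0r.
have := Jdot (V + V *m J Z); rewrite mulmxDl -mulmxA J2 mul_mx_scalar.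
rewrite !(dotDl, dotZl) !(dotC _ (_ + _)) !(dotDl, dotZl) !Jdot.
rewrite !(dotC V) => H.
have : 4 * (dot Z Z * dot (V *m J Z) V) = 0 by lra.
by move=> /eqP; rewrite !mulf_eq0 pnatr_eq0 (negPf ZN0) => /eqP.
Qed.

Definition ltrans (p q : E) : E :=
  (p.1.1 + Num.sqrt p.2 *: q.1.1,
   p.1.2 + p.2 *: q.1.2 + (2^-1 * Num.sqrt p.2) *: bracket p.1.1 q.1.1,
   p.2 * q.2).

Definition unit_pt : E := (0, 0, 1).

Definition inv_pt (p : E) : E :=
  (- (Num.sqrt p.2)^-1 *: p.1.1, - p.2^-1 *: p.1.2, p.2^-1).

Lemma ltrans_inv_pt (p : E) :
  clifford_rep J -> halfspace p -> ltrans (inv_pt p) p = unit_pt.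
Proof.
case: p => [[V Z] t] hJ t0; rewrite /halfspace /= in t0.
have bNn (a : R) : bracket (- (a *: V)) V = 0.
  rewrite -scaleNr; apply/rowP => i; by rewrite !mxE -scalemxAl dotZl (dot_skew _ _ hJ) mulr0.
rewrite /ltrans /inv_pt /unit_pt /= sqrtrV ?ltW //.
by rewrite !scaleNr !addNr bNn scaler0 addr0 mulVf ?gt_eqF.
Qed.

(* The left-invariant metric: tangent vectors at p are carried to T_e S by the
   differential of the left translation by p^-1.  *)
Definition metric (p X Y : E) : R :=
  ip ('D_X (ltrans (inv_pt p)) p) ('D_Y (ltrans (inv_pt p)) p).

Definition chi (u : E) (theta : R) : R :=
  (1 - u.2 * theta) ^+ 2 + enorm u.1.2 ^+ 2 * theta ^+ 2.

(* The affine part of the prolongation of the geodesic from e with initial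
   velocity u = (v, z, s).  *)
Definition prolong0 (u : E) (theta : R) : E :=
  ((2 * theta * (1 - u.2 * theta) / chi u theta) *: u.1.1
     + (2 * theta ^+ 2 / chi u theta) *: (u.1.1 *m J u.1.2),
   (2 * theta / chi u theta) *: u.1.2,
   (1 - theta ^+ 2) / chi u theta).

Definition prolong (p u : E) (theta : R) : E :=
  ltrans p (prolong0 u theta).

Definition geodesic (p u : E) (tau : R) : E :=
  prolong p u (tanh (tau / 2)).

Definition Dfun (x0 x : E) : R :=
  x.2^-1 * ((x.2 + x0.2 + enorm (2^-1 *: (x.1.1 - x0.1.1)) ^+ 2) ^+ 2
            + enorm (x.1.2 - x0.1.2 + 2^-1 *: bracket x.1.1 x0.1.1) ^+ 2).

Definition focal (x0 : E) : set E :=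
  [set x | halfspace x /\ Dfun x0 x = 0].

Lemma focalE (x0 x : E) : halfspace x ->
  focal x0 x <-> enorm (x.1.1 - x0.1.1) ^+ 2 = - (4 * (x.2 + x0.2)) /\
                 x.1.2 = x0.1.2 - 2^-1 *: bracket x.1.1 x0.1.1.
Proof.
case: x x0 => [[V Z] t] [[V0 Z0] t0] hx; rewrite /halfspace /= in hx.
rewrite /focal /Dfun /halfspace /= !enorm_sqr dotZl dotC dotZl.
set d := dot _ _; set b := _ *: bracket V V0.
have -> : (Z = Z0 - b) <-> (Z - Z0 + b = 0).
  by split=> [->|/eqP]; [rewrite addrAC subrK subrr|
     rewrite addr_eq0 => /eqP/(canRL (subrK _)) ->; rewrite addrC].
split=> [[_ /eqP]|[-> ->]]; last first.
  split=> //; rewrite [dot 0 0](_ : _ = 0); last first.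
    by rewrite -(scale0r 0) dotZl mul0r.
  by rewrite addr0 [X in X ^+ 2](_ : _ = 0) ?expr0n ?mulr0 //; lra.
rewrite mulf_eq0 invr_eq0 gt_eqF //= paddr_eq0 ?sqr_ge0 ?dot_ge0 //.
by rewrite sqrf_eq0 => /andP[/eqP ? /eqP/dot_eq0 ?]; split=> //; lra.
Qed.

(* F_circledast of the geodesic through p with initial velocity
   dL_p (v, 0, s), u = (v, 0, s); it is not defined when u.1.2 != 0.  *)
Definition focal_star (p u : E) : set E :=
  [set x | [/\ halfspace x, u.1.1 != 0, bracket (x.1.1 - p.1.1) u.1.1 = 0
             & dot (x.1.1 - p.1.1) u.1.1 = 2 * u.2 * Num.sqrt p.2]].

Definition focal_variety (p u : E) (F : set E) : Prop :=
  (exists x0 : E, x0.2 < 0 /\ F = focal x0) \/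
  (u.1.2 = 0 /\ F = focal_star p u).

(* Velocities at p of curves in F; this is T_p F for an embedded submanifold
   F.  *)
Definition tangent (F : set E) (p X : E) : Prop :=
  exists c : R -> E,
    [/\ c 0 = p, \forall h \near (0 : R), F (c h) & is_derive (0 : R) 1 c X].

Definition meets_orthogonally (c : R -> E) (tau : R) (F : set E) : Prop :=
  F (c tau) /\
  forall X : E, tangent F (c tau) X -> metric (c tau) (derive1 c tau) X = 0.

End Geometry.
End DamekRicci.

(* Main.v *)
Require Import Defs.
From mathcomp Require Import all_boot all_order all_algebra.
From mathcomp Require Import all_classical all_reals all_analysis.
From mathcomp Require Import ring lra.
Import Order.TTheory GRing.Theory Num.Theory.
Import numFieldNormedType.Exports.
Local Open Scope classical_set_scope.
Local Open Scope ring_scope.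

(** Fix a point q = (V, Z, t) of the geodesic, with velocity C = (C1, C2, C3)
there.  A focal variety F_x0 is the graph over v of a quadratic map, and given
V0 the condition q in F_x0 determines the other two components of x0, with
t0 = - t - |V - V0|^2 / 4 < 0; so the F_x0 through q are parametrized by the
vector W = V - V0 ([focal_centerP]).  The tangent space of F_x0 at q consists of
the (X, - [X, V0] / 2, - <X, W> / 2) with X in v ([tangent_focal]).  Written in
the left-invariant frame, orthogonality to C becomes the linear equation
(C3 + J_omega) W = 2 t C1, where omega = C2 - [V, C1] / 2 is, up to the factor
t, the z-component of C in that frame ([focal_orthogonalP]).  Since
(a + J_Z) (a - J_Z) = a^2 + |Z|^2, this equation has exactly one solution as
soon as (C3, omega) <> 0 ([exists_unique_focal]), and none when
(C3, omega) = 0 and C1 <> 0 ([no_focal_v_velocity]).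

It remains to see when (C3, omega) = 0.  Let u = (v, z, s) be the initial
velocity and theta = tanh (tau / 2), which lies in ]-1, 1[.  Up to positive
factors, omega is (1 - theta^2) z and C3 is
s (1 + theta^2) - (1 + s^2 + |z|^2) theta ([geodesic_velocity],
[omega_prolong0]).  If z <> 0 then omega <> 0, and only the varieties F_x0
compete.  If z = 0 then omega = 0 and C3 is proportional to
(s - theta) (1 - s theta), which vanishes exactly at theta = s; and this is also
exactly the parameter at which the geodesic meets F_circledast
([geodesic_star]).  So away from theta = s a single F_x0 is orthogonal to the
geodesic and F_circledast misses q, whereas at theta = s the velocity is a
nonzero multiple of v, no F_x0 is orthogonal to it, and F_circledast, whose
tangent vectors have v-component orthogonal to v, is. *)

Set Implicit Arguments.
Unset Strict Implicit.
Unset Printing Implicit Defensive.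

(** * The Euclidean product *)

Section DotTheory.
Context {R : realType} {k : nat}.
Implicit Types (x y z : 'rV[R]_k) (a : R).

Lemma dotDr x y z : dot x (y + z) = dot x y + dot x z.
Proof. by rewrite dotC dotDl !(dotC x). Qed.

Lemma dotZr a x y : dot x (a *: y) = a * dot x y.
Proof. by rewrite dotC dotZl dotC. Qed.

Lemma dotNl x y : dot (- x) y = - dot x y.
Proof. by rewrite -scaleN1r dotZl mulN1r. Qed.

Lemma dotNr x y : dot x (- y) = - dot x y.
Proof. by rewrite dotC dotNl dotC. Qed.

Lemma dotBl x y z : dot (x - y) z = dot x z - dot y z.
Proof. by rewrite dotDl dotNl. Qed.

Lemma dotBr x y z : dot x (y - z) = dot x y - dot x z.
Proof. by rewrite dotDr dotNr. Qed.

Lemma dot0l x : dot 0 x = 0.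
Proof. by rewrite -(scale0r 0) dotZl mul0r. Qed.

Lemma dot0r x : dot x 0 = 0.
Proof. by rewrite dotC dot0l. Qed.

Lemma dot_gt0 x : (0 < dot x x) = (x != 0).
Proof.
rewrite lt_neqAle dot_ge0 andbT eq_sym; congr (~~ _).
by apply/eqP/eqP => [/dot_eq0|->]; rewrite ?dot0l.
Qed.

Lemma dot_inj x y : (forall z, dot x z = dot y z) -> x = y.
Proof.
by move=> xy; apply/eqP; rewrite -subr_eq0; apply/eqP/dot_eq0; rewrite dotBl xy subrr.
Qed.

End DotTheory.

(** * Clifford operators and the bracket *)

Section CliffordTheory.
Context {R : realType} {n m : nat}.
Variables (J : {linear 'rV[R]_m -> 'M[R]_n}) (hJ : clifford_rep J).
Implicit Types (U V W : 'rV[R]_n) (Z : 'rV[R]_m) (a : R).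

(** Polarization of [dot_skew]. *)
Lemma dot_skewC U V Z : dot (U *m J Z) V = - dot U (V *m J Z).
Proof.
have := dot_skew (V + U) Z hJ.
rewrite mulmxDl !(dotDl, dotDr) !(dot_skew _ _ hJ) add0r addr0.
by rewrite (dotC U) => /eqP; rewrite addr_eq0 => /eqP.
Qed.

Lemma bracketDl U V W : bracket J (U + V) W = bracket J U W + bracket J V W.
Proof. by apply/rowP => i; rewrite !mxE mulmxDl dotDl. Qed.

Lemma bracketDr U V W : bracket J W (U + V) = bracket J W U + bracket J W V.
Proof. by apply/rowP => i; rewrite !mxE dotDr. Qed.

Lemma bracketZl a U W : bracket J (a *: U) W = a *: bracket J U W.
Proof. by apply/rowP => i; rewrite !mxE -scalemxAl dotZl. Qed.

Lemma bracketZr a U W : bracket J W (a *: U) = a *: bracket J W U.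
Proof. by apply/rowP => i; rewrite !mxE dotZr. Qed.

Lemma bracketNr U W : bracket J W (- U) = - bracket J W U.
Proof. by rewrite -scaleN1r bracketZr scaleN1r. Qed.

Lemma bracketC U V : bracket J U V = - bracket J V U.
Proof.
by apply: dot_inj => Z; rewrite dotNl !bracketP dot_skewC // dotC.
Qed.

Lemma bracketvv V : bracket J V V = 0.
Proof. by apply: dot_inj => Z; rewrite bracketP dot0l dot_skew. Qed.

Lemma dot_mulJ V Z : dot (V *m J Z) (V *m J Z) = dot Z Z * dot V V.
Proof. by rewrite -!enorm_sqr (proj2 hJ) exprMn. Qed.

(** Pairing with Y turns the left side into <J_Y V, J_Z V>, which is
<Y, Z> |V|^2 by polarizing |J_Z V| = |Z| |V| in Z. *)
Lemma bracket_mulJ V Z : bracket J V (V *m J Z) = dot V V *: Z.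
Proof.
apply: dot_inj => Y; rewrite bracketP dotZl.
have := dot_mulJ V (Y + Z).
rewrite linearD mulmxDr !(dotDl, dotDr) !dot_mulJ.
rewrite (dotC (V *m J Z)) (dotC Y Z) => ?; lra.
Qed.

Lemma clifford_shiftK a Z W :
  W *m (a%:M + J Z) *m (a%:M - J Z) = (a ^+ 2 + dot Z Z) *: W.
Proof.
rewrite -mulmxA mulmxBr !mulmxDl !mul_mx_scalar mul_scalar_mx (proj1 hJ).
rewrite opprD addrA addrK -raddfN opprK scale_scalar_mx -raddfD.
by rewrite mul_mx_scalar expr2.
Qed.

(** The linear system that selects a focal variety is solved by the conjugate
operator a - J_Z. *)
Lemma clifford_shift_eq a Z W U : a ^+ 2 + dot Z Z != 0 ->
  W *m (a%:M + J Z) = U <-> W = (a ^+ 2 + dot Z Z)^-1 *: (U *m (a%:M - J Z)).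
Proof.
move=> aZ0; split=> [<-|->]; first by rewrite clifford_shiftK scalerA mulVf ?scale1r.
have := clifford_shiftK a (- Z) U; rewrite linearN opprK dotNl dotNr opprK => {}E.
by rewrite -scalemxAl E scalerA mulVf ?scale1r.
Qed.

End CliffordTheory.

(** * Derivatives of scalar functions *)

Section Calculus.
Context {R : realType}.

Lemma is_derive_scalel (V : normedModType R) (f : R -> R) (x df : R) (w : V) :
  is_derive x 1 f df -> is_derive x 1 (fun h => f h *: w) (df *: w).
Proof.
move=> [fx <-].
suff E : (fun h : R => h^-1 *: (((fun y => f y *: w) \o shift x) (h *: 1) - f x *: w)) @ 0^'
    --> 'D_1 f x *: w.
  by apply: DeriveDef; [apply/cvg_ex; eexists; exact: E | apply: cvg_lim].
under eq_fun => h do rewrite /= -scalerBl scalerA.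
exact: cvgZr_tmp.
Qed.

Lemma is_derive_quadratic (a b c x : R) :
  is_derive x 1 (fun y => a + b * y + c * y ^+ 2) (b + 2 * c * x).
Proof.
have -> : (fun y => a + b * y + c * y ^+ 2) = horner (a%:P + b%:P * 'X + c%:P * 'X^2).
  by apply/funext => y; rewrite !hornerE.
apply: is_derive_eq; rewrite !(derivD, derivC, derivM, derivX, derivXn, hornerE) /=. ring.
Qed.

Lemma is_derive_ratio (f g : R -> R) (x df dg : R) :
  is_derive x 1 f df -> is_derive x 1 g dg -> g x != 0 ->
  is_derive x 1 (fun y => f y / g y) ((df * g x - f x * dg) / g x ^+ 2).
Proof.
move=> hf hg gx0.
have hV : is_derive x 1 (fun y => (g y)^-1) (- g x ^- 2 *: dg).
  by case: hg => ? <-; apply: DeriveDef; [exact: derivableV | exact: deriveV].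
apply: (trigger_derive (is_deriveM hf hV)) => /=.
by rewrite /GRing.scale /=; field.
Qed.

(** This form makes both the bounds and the derivative immediate. *)
Lemma tanh_halfE (x : R) : tanh (x / 2) = 1 - 2 / (expR x + 1).
Proof.
have -> : expR x = expR (x / 2) * expR (x / 2) by rewrite -expRD; congr expR; field.
rewrite /tanh expRN; have := expR_gt0 (x / 2); move: (expR _) => a a0.
by field; rewrite !lt0r_neq0 //; nra.
Qed.

Lemma tanh_half_itv (x : R) : -1 < tanh (x / 2) < 1.
Proof.
rewrite tanh_halfE; have e0 := expR_gt0 x.
have : 0 < 2 / (expR x + 1) by rewrite divr_gt0 // addr_gt0.
have : 2 / (expR x + 1) < 2 by rewrite ltr_pdivrMr ?addr_gt0 //; lra.
move=> *; lra.
Qed.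

Lemma is_derive_tanh_half (x : R) :
  exists2 l : R, 0 < l & is_derive x 1 (fun y : R => tanh (y / 2)) l.
Proof.
exists (2 * expR x / (expR x + 1) ^+ 2).
  by rewrite divr_gt0 ?mulr_gt0 ?exprn_gt0 ?addr_gt0 ?expR_gt0.
under eq_fun => y do rewrite tanh_halfE.
have e1 : expR x + 1 != 0 by rewrite lt0r_neq0 ?addr_gt0 ?expR_gt0.
have hg : is_derive x 1 (fun y : R => expR y + 1) (expR x).
  have -> : (fun y : R => expR y + 1) = expR + cst 1 by [].
  by apply: is_derive_eq; rewrite addr0.
have hq := is_derive_ratio (is_derive_cst (2 : R) x 1) hg e1.
have -> : (fun y : R => 1 - 2 / (expR y + 1)) = cst 1 - (fun y => cst 2 y / (expR y + 1)) by [].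
by apply: is_derive_eq; rewrite /=; field.
Qed.

End Calculus.

(** * Derivatives of curves in the ambient space *)

Section Ambient.
Context {R : realType} {n m : nat}.
Local Notation E := (amb R n m).

Lemma continuous_dot k (w : 'rV[R]_k) : continuous (fun x : 'rV[R]_k => dot x w).
Proof.
move=> x; apply: cvg_big => [||i _]; [exact: add_continuous | exact: nbhs_filter |].
exact: (cvgMr_tmp (@coord_continuous R 1 k 0 i x)).
Qed.

Lemma continuous_ip (w : E) : continuous (fun X : E => ip X w).
Proof.
have c11 : continuous (fun X : E => X.1.1).
  by move=> X; apply: (@cvg_comp _ _ _ fst fst _ (nbhs X.1)); exact: cvg_fst.
have c12 : continuous (fun X : E => X.1.2).
  by move=> X; apply: (@cvg_comp _ _ _ fst snd _ (nbhs X.1)); [exact: cvg_fst | exact: cvg_snd].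
move=> X; apply: cvgD; [apply: cvgD|].
- exact: (continuous_comp (c11 X) (@continuous_dot _ w.1.1 _)).
- exact: (continuous_comp (c12 X) (@continuous_dot _ w.1.2 _)).
- by apply: cvgMr_tmp; exact: cvg_snd.
Qed.

Lemma ip_lin a (X Y w : E) : ip (a *: X + Y) w = a * ip X w + ip Y w.
Proof. by rewrite /ip /= !(dotDl, dotZl) /GRing.scale /=; ring. Qed.

Lemma ipB (X Y w : E) : ip (X - Y) w = ip X w - ip Y w.
Proof. by rewrite -scaleN1r addrC ip_lin; ring. Qed.

Lemma ipZ a (X w : E) : ip (a *: X) w = a * ip X w.
Proof. by rewrite /ip /= !dotZl /GRing.scale /=; ring. Qed.

(** Constraints on a curve are differentiated by pairing it with constant
vectors, since [X => ip X w] is linear and continuous. *)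
Lemma is_derive_ip (c : R -> E) (x : R) (X w : E) :
  is_derive x 1 c X -> is_derive x 1 (fun h => ip (c h) w) (ip X w).
Proof.
move=> [cx <-].
suff H : (fun h : R => h^-1 *: (((fun y => ip (c y) w) \o shift x) (h *: 1) - ip (c x) w)) @ 0^'
    --> ip ('D_1 c x) w.
  by apply: DeriveDef; [apply/cvg_ex; eexists; exact: H | apply: cvg_lim].
under eq_fun => h do rewrite /= -ipB -[_ *: ip _ _]/(_ * ip _ _) -ipZ.
exact: (cvg_comp _ _ cx (@continuous_ip w _)).
Qed.

Lemma is_derive_dotl (c : R -> E) (x : R) (X : E) (w : 'rV[R]_n) :
  is_derive x 1 c X -> is_derive x 1 (fun h => dot (c h).1.1 w) (dot X.1.1 w).
Proof.
move/(is_derive_ip (w, 0, 0)); rewrite /ip /=.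
by under eq_fun do rewrite dot0r mulr0 !addr0; rewrite dot0r mulr0 !addr0.
Qed.

Lemma is_derive_sqnorm (c : R -> E) (x : R) (X : E) (w : 'rV[R]_n) :
  is_derive x 1 c X ->
  is_derive x 1 (fun h => dot ((c h).1.1 - w) ((c h).1.1 - w))
    (2 * dot X.1.1 ((c x).1.1 - w)).
Proof.
move=> cX.
have hi (i : 'I_n) : is_derive x 1 (fun h => (c h).1.1 0 i - w 0 i) (X.1.1 0 i).
  have E1 (Y : 'rV[R]_n) : Y 0 i = dot Y (delta_mx 0 i).
    rewrite /dot (bigD1 i) //= big1 => [|j ji].
      by rewrite mxE !eqxx mulr1 addr0.
    by rewrite mxE eqxx (negPf ji) mulr0.
  have := is_deriveB (is_derive_dotl (delta_mx 0 i) cX) (is_derive_cst (w 0 i) x 1).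
  rewrite subr0 -E1; congr is_derive; apply/funext => h.
  by rewrite [RHS](congr1 (fun a => a - w 0 i) (E1 _)).
have -> : (fun h => dot ((c h).1.1 - w) ((c h).1.1 - w)) =
    \sum_(i < n) ((fun h => (c h).1.1 0 i - w 0 i) * (fun h => (c h).1.1 0 i - w 0 i)).
  by apply/funext => h; rewrite fct_sumE; apply: eq_bigr => i _; rewrite !mxE.
apply: is_derive_eq; rewrite /dot mulr_sumr; apply: eq_bigr => i _.
by rewrite !mxE /GRing.scale /=; ring.
Qed.

(** An equation satisfied along a curve yields a linear condition on its velocity. *)
Lemma is_derive_near_cst (f : R -> R) (x a df : R) :
  is_derive x 1 f df -> (\forall h \near x, f h = a) -> df = 0.
Proof.
move=> [_ <-] fa; rewrite (near_eq_derive _ (g := cst a)) //.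
exact: derive_cst.
Qed.

End Ambient.

(** * Focal varieties orthogonal to a given velocity *)

Section Geometry.
Context {R : realType} {n m : nat}.
Local Notation E := (amb R n m).
Variables (J : {linear 'rV[R]_m -> 'M[R]_n}) (hJ : clifford_rep J).
Implicit Types (p q x X Y C : E).

(** The linear part of [ltrans J p], hence its differential at every point. *)
Definition dltrans p X : E :=
  (Num.sqrt p.2 *: X.1.1,
   p.2 *: X.1.2 + (2^-1 * Num.sqrt p.2) *: bracket J p.1.1 X.1.1,
   p.2 * X.2).

Lemma ltransE p q : ltrans J p q = (p.1.1, p.1.2, 0) + dltrans p q.
Proof. by rewrite /ltrans -addrA -[p.2 * q.2]add0r. Qed.

Lemma dltransD p X Y : dltrans p (X + Y) = dltrans p X + dltrans p Y.
Proof.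
rewrite /dltrans /= bracketDr !scalerDr mulrDr; congr (_, _, _).
by rewrite addrACA.
Qed.

Lemma dltransZ p a X : dltrans p (a *: X) = a *: dltrans p X.
Proof.
rewrite /dltrans /= bracketZr; congr (_, _, _).
- by rewrite !scalerA mulrC.
- by rewrite /= scalerDr !scalerA ![_ * a]mulrC.
- by rewrite /GRing.scale /= mulrCA.
Qed.

(** The difference quotient of an affine map is constant. *)
Lemma derive_ltrans p q X : 'D_X (ltrans J p) q = dltrans p X.
Proof.
apply: cvg_lim => //; apply: cvg_near_cst.
near=> h.
rewrite /= !ltransE opprD addrACA subrr add0r dltransD addrK dltransZ scalerA.
by rewrite mulVf ?scale1r //; near: h; exact: nbhs_dnbhs_neq.
Unshelve. all: by end_near. Qed.

(** [q.2^-1 *: omega q X] is the z-component of X in the left-invariant frame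
at q. *)
Definition omega q X : 'rV[R]_m := X.1.2 - 2^-1 *: bracket J q.1.1 X.1.1.

(** This is left invariance: the term in [p.1.1] that [dltrans p] produces in the
z-component cancels against the one contributed by the base point. *)
Lemma omega_ltrans p q X : 0 < p.2 ->
  omega (ltrans J p q) (dltrans p X) = p.2 *: omega q X.
Proof.
move=> p0; rewrite /omega /= bracketDl !bracketZr bracketZl !scalerDr !scalerN.
rewrite !scalerA -expr2 sqr_sqrtr ?ltW // opprD addrA addrK.
by rewrite mulrC.
Qed.

Lemma metricE q X Y : halfspace q ->
  metric J q X Y = q.2^-1 * dot X.1.1 Y.1.1
    + q.2 ^- 2 * (dot (omega q X) (omega q Y) + X.2 * Y.2).
Proof.
rewrite /halfspace /= => q0.
have dE Z : dltrans (inv_pt q) Z =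
    ((Num.sqrt q.2)^-1 *: Z.1.1, q.2^-1 *: omega q Z, q.2^-1 * Z.2).
  rewrite /dltrans /= sqrtrV ?ltW //; congr (_, _, _).
  rewrite scaleNr -scaleN1r !bracketZl !scalerA /omega scalerDr scalerN scalerA.
  rewrite -scaleNr; congr (_ + _ *: _).
  by rewrite -[in RHS](sqr_sqrtr (ltW q0)) expr2 invfM; ring.
rewrite /metric !derive_ltrans !dE /ip /= !(dotZl, dotZr) mulrA -invfM -expr2.
by rewrite sqr_sqrtr ?ltW //; field; rewrite lt0r_neq0.
Qed.

(** A differentiable curve is continuous, so it stays in the open half-space. *)
Lemma near_halfspace (c : R -> E) (x : R) X :
  is_derive x 1 c X -> halfspace (c x) -> \forall h \near x, halfspace (c h).
Proof.
rewrite /halfspace /= => cX c0.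
have [d _] := is_derive_ip (0, 0, 1) cX.
have ipE Y : ip Y (0, 0, 1) = Y.2 by rewrite /ip /= !dot0r mulr1 !add0r.
have /differentiable_continuous cc := (derivable1_diffP _ _).1 d.
have : \forall h \near x, 0 < ip (c h) (0, 0, 1).
  by apply: (cvgr_gt _ cc); rewrite ipE.
by apply: filterS => h; rewrite ipE.
Qed.

Lemma focal_coords x0 q : focal J x0 q ->
  q.1.2 = x0.1.2 - 2^-1 *: bracket J q.1.1 x0.1.1 /\
  q.2 = - x0.2 - 4^-1 * dot (q.1.1 - x0.1.1) (q.1.1 - x0.1.1).
Proof.
by move=> F; have := (focalE J x0 F.1).1 F; rewrite enorm_sqr => -[? ->]; split=> //; lra.
Qed.

(** One inclusion differentiates the two equations of the focal variety; for the
other, the curve over the segment [h => q.1.1 + h *: X.1.1] of v is quadratic in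
h, because |V - V0|^2 is. *)
Lemma tangent_focal x0 q X : focal J x0 q ->
  tangent (focal J x0) q X <->
  X.1.2 = - (2^-1 *: bracket J X.1.1 x0.1.1) /\
  X.2 = - (2^-1 * dot X.1.1 (q.1.1 - x0.1.1)).
Proof.
move=> Fq; split.
  move=> [c [c0 cF cX]]; split.
    apply: dot_inj => Z; rewrite dotNl dotZl bracketP dot_skewC //.
    (* Pairing the z-equation with Z, and moving J_Z onto x0 by skewness. *)
    pose w : E := (- (2^-1 *: (x0.1.1 *m J Z)), Z, 0).
    have : ip X w = 0.
      apply: (is_derive_near_cst (a := dot x0.1.2 Z) (is_derive_ip w cX)).
      near=> h; have /focal_coords[+ _] : focal J x0 (c h) by near: h.
      rewrite /ip /= mulr0 addr0 => ->.
      rewrite dotBl dotNr !dotZr dotZl bracketP (dot_skewC hJ); ring.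
    rewrite /ip /= mulr0 addr0 dotNr dotZr; lra.
  (* The sum t + |V - V0|^2 / 4 equals - t0 along the curve. *)
  have : ip X (0, 0, 1) + 4^-1 * (2 * dot X.1.1 ((c 0).1.1 - x0.1.1)) = 0.
    have d1 := is_derive_ip (0, 0, 1) cX.
    have d2 := is_deriveZ 4^-1 (is_derive_sqnorm x0.1.1 cX).
    apply: (is_derive_near_cst (a := - x0.2) (is_deriveD d1 d2)).
    near=> h; have /focal_coords[_ ht] : focal J x0 (c h) by near: h.
    rewrite -[LHS]/(ip (c h) (0, 0, 1) + 4^-1 * dot ((c h).1.1 - x0.1.1) ((c h).1.1 - x0.1.1)).
    by rewrite /ip /= !dot0r ht; ring.
  rewrite /ip /= !dot0r c0; lra.
move=> [X12 X2].
pose c h : E := q + h *: X + h ^+ 2 *: ((0, 0, - (4^-1 * dot X.1.1 X.1.1)) : E).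
have c0 : c 0 = q by rewrite /c scale0r expr0n scale0r !addr0.
have cX : is_derive (0 : R) 1 c X.
  have sq : is_derive (0 : R) 1 (fun h => h ^+ 2) 0.
    have := is_derive_quadratic (0 : R) 0 1 0; rewrite mulr0 addr0.
    by under eq_fun do rewrite mul0r !add0r mul1r.
  have := is_deriveD (is_deriveD (is_derive_cst q (0 : R) 1)
    (is_derive_scalel X (is_derive_id (0 : R) 1))) (is_derive_scalel
      ((0, 0, - (4^-1 * dot X.1.1 X.1.1)) : E) sq).
  by rewrite scale1r scale0r add0r addr0.
exists c; split.
- exact: c0.
- near=> h; apply/focalE; first by near: h; apply: (near_halfspace cX); rewrite c0; exact: Fq.1.
  have [qZ qt] := focal_coords Fq; rewrite enorm_sqr; split.
    rewrite /c /= qt X2 (_ : _ - _ = (q.1.1 - x0.1.1) + h *: X.1.1); last first.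
      by rewrite scaler0 addr0 addrAC.
    move: (q.1.1 - x0.1.1) => W; rewrite !(dotDl, dotDr, dotZl, dotZr) (dotC W).
    by rewrite /GRing.scale /=; field.
  rewrite /c /= scaler0 addr0 scaler0 addr0 bracketDl bracketZl qZ X12.
  by rewrite scalerDr opprD scalerN !scalerA [h * _]mulrC -addrA.
- exact: cX.
Unshelve. all: by end_near.
Qed.


(** On tangent vectors of the focal variety, the inner product with C only
depends on the v-component, and skewness of J moves J_omega onto
[q.1.1 - x0.1.1]. *)
Lemma metric_focal x0 q C X : focal J x0 q -> tangent (focal J x0) q X ->
  metric J q C X = 2^-1 * q.2 ^- 2 *
    dot X.1.1 ((2 * q.2) *: C.1.1 - (q.1.1 - x0.1.1) *m (C.2%:M + J (omega q C))).
Proof.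
move=> Fq /(tangent_focal _ Fq)[X12 X2]; have q0 := Fq.1.
rewrite metricE //.
(* Antisymmetry combines [X, V0] and [V, X] into a bracket with V - V0. *)
have -> : omega q X = 2^-1 *: bracket J X.1.1 (q.1.1 - x0.1.1).
  rewrite /omega X12 (bracketC hJ q.1.1) bracketDr bracketNr scalerN opprK.
  by rewrite addrC scalerDr scalerN.
rewrite dotZr (dotC (omega _ _)) bracketP dot_skewC // X2; move: (q.1.1 - x0.1.1) => W.
rewrite dotBr dotZr mulmxDr dotDr mul_mx_scalar dotZr (dotC C.1.1).
by field; rewrite lt0r_neq0.
Qed.

Lemma focal_orthogonalP x0 q C : focal J x0 q ->
  (forall X, tangent (focal J x0) q X -> metric J q C X = 0) <->
  (q.1.1 - x0.1.1) *m (C.2%:M + J (omega q C)) = (2 * q.2) *: C.1.1.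
Proof.
move=> Fq; have q0 := Fq.1; split=> [orth|eqW X tX]; last first.
  by rewrite (metric_focal _ Fq tX) eqW subrr dot0r mulr0.
(* The defect U of the equation is tested against the tangent vector over U. *)
apply/esym/eqP; rewrite -subr_eq0; set U := _ - _; apply/eqP/dot_eq0.
pose X : E := (U, - (2^-1 *: bracket J U x0.1.1), - (2^-1 * dot U (q.1.1 - x0.1.1))).
have tX : tangent (focal J x0) q X by apply/tangent_focal.
have /eqP := orth X tX; rewrite (metric_focal _ Fq tX) -/U /=.
rewrite !mulf_eq0 !invr_eq0 pnatr_eq0 expf_eq0 /=.
by rewrite (gt_eqF q0) => /eqP.
Qed.

(** The point x0 for which F_x0 passes through q with [q.1.1 - x0.1.1 = W]. *)
Definition focal_center q (W : 'rV[R]_n) : E :=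
  (q.1.1 - W, q.1.2 + 2^-1 *: bracket J q.1.1 (q.1.1 - W), - q.2 - 4^-1 * dot W W).

Lemma focal_centerP q W x0 : halfspace q ->
  focal J x0 q /\ q.1.1 - x0.1.1 = W <-> x0 = focal_center q W.
Proof.
move=> q0; split=> [[Fq <-]|->].
  have [eZ et] := focal_coords Fq; rewrite /focal_center subKr.
  rewrite eZ subrK et.
  by case: x0 {Fq eZ et} => [[V0 Z0] t0] /=; congr (_, _, _); ring.
split; last by rewrite /= subKr.
apply/focalE => //; rewrite enorm_sqr /= subKr; split; last by rewrite addrK.
by field.
Qed.

Lemma exists_unique_focal q C : halfspace q ->
  C.2 ^+ 2 + dot (omega q C) (omega q C) != 0 ->
  exists! x0, focal J x0 q /\
    forall X, tangent (focal J x0) q X -> metric J q C X = 0.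
Proof.
move=> q0 C0; pose W := (C.2 ^+ 2 + dot (omega q C) (omega q C))^-1 *:
  (((2 * q.2) *: C.1.1) *m (C.2%:M - J (omega q C))).
exists (focal_center q W); split=> [|x0 [Fq]].
  have [Fq EW] := (focal_centerP W (focal_center q W) q0).2 erefl.
  by split=> //; apply/focal_orthogonalP=> //; apply/clifford_shift_eq.
move/(focal_orthogonalP _ Fq)/(clifford_shift_eq hJ) => /(_ C0) EW.
by apply/esym/focal_centerP.
Qed.

Lemma no_focal_v_velocity x0 q C : C.2 = 0 -> omega q C = 0 -> C.1.1 != 0 ->
  focal J x0 q -> ~ (forall X, tangent (focal J x0) q X -> metric J q C X = 0).
Proof.
move=> C2 oC C1 Fq /(focal_orthogonalP _ Fq)/esym/eqP.
rewrite C2 oC linear0 raddf0 addr0 mulmx0 scaler_eq0 (negPf C1) orbF.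
by rewrite mulf_eq0 pnatr_eq0 (gt_eqF Fq.1).
Qed.

(** With C directed along the initial v-component, only the v-component of a
tangent vector matters, and the affine equation defining the variety makes it
orthogonal to that direction. *)
Lemma star_orthogonal p u q C : focal_star J p u q -> C.2 = 0 -> omega q C = 0 ->
  (exists a, C.1.1 = a *: u.1.1) ->
  forall X, tangent (focal_star J p u) q X -> metric J q C X = 0.
Proof.
move=> Fq C2 oC [a C1] X [c [c0 cF cX]].
have q0 : halfspace q by case: Fq.
rewrite metricE // C2 oC dot0l mul0r addr0 mulr0 addr0 C1 dotZl dotC.
suff -> : dot X.1.1 u.1.1 = 0 by rewrite !mulr0.
apply: (is_derive_near_cst (a := dot p.1.1 u.1.1 + 2 * u.2 * Num.sqrt p.2)
  (is_derive_dotl u.1.1 cX)).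
near=> h; have [_ _ _ <-] : focal_star J p u (c h) by near: h.
by rewrite dotBl addrC subrK.
Unshelve. all: by end_near. Qed.

End Geometry.

(** * The velocity of a geodesic *)

Section Velocity.
Context {R : realType} {n m : nat}.
Local Notation E := (amb R n m).
Variables (J : {linear 'rV[R]_m -> 'M[R]_n}) (hJ : clifford_rep J).
Implicit Types (p q u X : E) (th : R).

Lemma omegaZ a q X : omega J q (a *: X) = a *: omega J q X.
Proof. by rewrite /omega /= bracketZr scalerBr !scalerA mulrC. Qed.

Definition sqnorm_za u : R := u.2 ^+ 2 + dot u.1.2 u.1.2.

Lemma chiE u th : chi u th = 1 + - (2 * u.2) * th + sqnorm_za u * th ^+ 2.
Proof. by rewrite /chi enorm_sqr /sqnorm_za; ring. Qed.

Lemma sqnorm_v u : ip u u = 1 -> dot u.1.1 u.1.1 = 1 - sqnorm_za u.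
Proof. by rewrite /ip /sqnorm_za; lra. Qed.

(** |s| <= 1 for a unit vector, so |s theta| < 1. *)
Lemma shift_gt0 u th : ip u u = 1 -> -1 < th < 1 -> 0 < 1 - u.2 * th.
Proof.
rewrite /ip => hu th1; have := dot_ge0 u.1.1; have := dot_ge0 u.1.2 => ? ?; nra.
Qed.

Lemma chi_gt0 u th : ip u u = 1 -> -1 < th < 1 -> 0 < chi u th.
Proof.
move=> hu th1; rewrite /chi ltr_wpDr //.
  by rewrite mulr_ge0 ?sqr_ge0.
by rewrite exprn_gt0 // shift_gt0.
Qed.

(** The derivative of [prolong0 J u] is [2 / chi u th ^+ 2] times this vector;
clearing the positive factor leaves polynomials in th. *)
Definition prolong0_dir u th : E :=
  ((1 - 2 * u.2 * th + (2 * u.2 ^+ 2 - sqnorm_za u) * th ^+ 2) *: u.1.1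
     + (2 * th * (1 - u.2 * th)) *: (u.1.1 *m J u.1.2),
   (1 - sqnorm_za u * th ^+ 2) *: u.1.2,
   u.2 * (1 + th ^+ 2) - (1 + sqnorm_za u) * th).

(** All the coefficients of the prolongation have this form, so one
differentiation covers them. *)
Definition quad_over_chi u (a b c th : R) : R :=
  (a + b * th + c * th ^+ 2) / chi u th.

Lemma is_derive_quad_over_chi u (a b c th : R) : chi u th != 0 ->
  is_derive th 1 (quad_over_chi u a b c)
    (((b + 2 * c * th) * chi u th
      - (a + b * th + c * th ^+ 2) * (- (2 * u.2) + 2 * sqnorm_za u * th)) / chi u th ^+ 2).
Proof.
move=> h0; apply: is_derive_ratio => //; first exact: is_derive_quadratic.
have -> : chi u = (fun y => 1 + - (2 * u.2) * y + sqnorm_za u * y ^+ 2).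
  by apply/funext => y; exact: chiE.
exact: is_derive_quadratic.
Qed.

Lemma prolong0_sum u th : prolong0 J u th =
  quad_over_chi u 0 2 (- (2 * u.2)) th *: ((u.1.1, 0, 0) : E)
  + quad_over_chi u 0 0 2 th *: ((u.1.1 *m J u.1.2, 0, 0) : E)
  + quad_over_chi u 0 2 0 th *: ((0, u.1.2, 0) : E)
  + quad_over_chi u 1 0 (-1) th *: ((0, 0, 1) : E).
Proof.
have E1 : 2 * th * (1 - u.2 * th) / chi u th = quad_over_chi u 0 2 (- (2 * u.2)) th.
  by rewrite /quad_over_chi; congr (_ / _); ring.
have E2 : 2 * th ^+ 2 / chi u th = quad_over_chi u 0 0 2 th.
  by rewrite /quad_over_chi; congr (_ / _); ring.
have E3 : 2 * th / chi u th = quad_over_chi u 0 2 0 th.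
  by rewrite /quad_over_chi; congr (_ / _); ring.
have E4 : (1 - th ^+ 2) / chi u th = quad_over_chi u 1 0 (-1) th.
  by rewrite /quad_over_chi; congr (_ / _); ring.
rewrite /prolong0 E1 E2 E3 E4; congr (_, _, _).
- by rewrite /= !scaler0 !addr0.
- by rewrite /= !scaler0 !add0r addr0.
- by rewrite /= !scaler0 !add0r [RHS]mulr1.
Qed.

Lemma prolong0_dir_sum u th : prolong0_dir u th =
  (1 - 2 * u.2 * th + (2 * u.2 ^+ 2 - sqnorm_za u) * th ^+ 2) *: ((u.1.1, 0, 0) : E)
  + (2 * th * (1 - u.2 * th)) *: ((u.1.1 *m J u.1.2, 0, 0) : E)
  + (1 - sqnorm_za u * th ^+ 2) *: ((0, u.1.2, 0) : E)
  + (u.2 * (1 + th ^+ 2) - (1 + sqnorm_za u) * th) *: ((0, 0, 1) : E).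
Proof.
rewrite /prolong0_dir; congr (_, _, _).
- by rewrite /= !scaler0 !addr0.
- by rewrite /= !scaler0 !add0r addr0.
- by rewrite /= !scaler0 !add0r [RHS]mulr1.
Qed.

Lemma is_derive_comb4 (V : normedModType R) (w0 w1 w2 w3 w4 : V) (x : R)
    (f1 f2 f3 f4 : R -> R) (d1 d2 d3 d4 : R) :
  is_derive x 1 f1 d1 -> is_derive x 1 f2 d2 ->
  is_derive x 1 f3 d3 -> is_derive x 1 f4 d4 ->
  is_derive x 1 (fun t => w0 + (f1 t *: w1 + f2 t *: w2 + f3 t *: w3 + f4 t *: w4))
    (d1 *: w1 + d2 *: w2 + d3 *: w3 + d4 *: w4).
Proof.
move=> h1 h2 h3 h4.
have := is_deriveD (is_derive_cst w0 x 1) (is_deriveD (is_deriveD (is_deriveD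
  (is_derive_scalel w1 h1) (is_derive_scalel w2 h2))
  (is_derive_scalel w3 h3)) (is_derive_scalel w4 h4)).
by rewrite add0r.
Qed.

Lemma geodesic_velocity p u tau : ip u u = 1 -> exists2 l, 0 < l &
  derive1 (geodesic J p u) tau = l *: dltrans J p (prolong0_dir u (tanh (tau / 2))).
Proof.
move=> hu; set th := tanh _; have c0 := chi_gt0 hu (tanh_half_itv tau).
rewrite -/th in c0; have cN0 := lt0r_neq0 c0.
have [d d0 dth] := is_derive_tanh_half tau.
exists (d * (2 / chi u th ^+ 2)); first by rewrite !mulr_gt0 ?invr_gt0 ?exprn_gt0.
have H a b c : is_derive tau 1 (fun t => quad_over_chi u a b c (tanh (t / 2))) _ :=
  @is_derive1_comp _ _ (fun y : R => tanh (y / 2)) tau _ _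
    (is_derive_quad_over_chi a b c cN0) dth.
have -> : geodesic J p u = fun t => ((p.1.1, p.1.2, 0) : E) +
  (quad_over_chi u 0 2 (- (2 * u.2)) (tanh (t / 2)) *: dltrans J p (u.1.1, 0, 0)
   + quad_over_chi u 0 0 2 (tanh (t / 2)) *: dltrans J p (u.1.1 *m J u.1.2, 0, 0)
   + quad_over_chi u 0 2 0 (tanh (t / 2)) *: dltrans J p (0, u.1.2, 0)
   + quad_over_chi u 1 0 (-1) (tanh (t / 2)) *: dltrans J p (0, 0, 1)).
  by apply/funext => t; rewrite /geodesic /prolong ltransE prolong0_sum !dltransD !dltransZ.
rewrite derive1E.
have [_ ->] := is_derive_comb4 (p.1.1, p.1.2, 0) (dltrans J p (u.1.1, 0, 0))
  (dltrans J p (u.1.1 *m J u.1.2, 0, 0)) (dltrans J p (0, u.1.2, 0)) (dltrans J p (0, 0, 1))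
  (H 0 2 (- (2 * u.2))) (H 0 0 2) (H 0 2 0) (H 1 0 (-1)).
rewrite prolong0_dir_sum !dltransD !dltransZ !scalerDr !scalerA.
move: cN0; rewrite chiE => cN0.
by do ?congr (_ + _); congr (_ *: _); field.
Qed.

(** [bracket_mulJ] makes the bracket a multiple of z with factor
|v|^2 = 1 - s^2 - |z|^2, so that both terms of [omega] are multiples of z. *)
Lemma omega_prolong0 u th : ip u u = 1 -> chi u th != 0 ->
  omega J (prolong0 J u th) (prolong0_dir u th) = (1 - th ^+ 2) *: u.1.2.
Proof.
move=> /sqnorm_v hu c0; rewrite /omega /= !(bracketDl, bracketDr, bracketZl, bracketZr).
rewrite !bracketvv // (bracketC hJ (_ *m _)) !bracket_mulJ // hu.
rewrite !scaler0 add0r addr0 !scalerN !scalerA -scaleNr -scalerDl scalerA -scalerBl.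
congr (_ *: _); move: c0; rewrite chiE => c0; by field; exact: c0.
Qed.

Lemma halfspace_geodesic p u tau : halfspace p -> ip u u = 1 ->
  halfspace (geodesic J p u tau).
Proof.
rewrite /halfspace /= => p0 hu; have th1 := tanh_half_itv tau.
rewrite mulr_gt0 // divr_gt0 ?chi_gt0 //; move: (tanh _) th1 => th th1; nra.
Qed.

(** The v-component of the geodesic minus that of p is a multiple of v, so the
bracket condition is automatic and the scalar one reads
theta (1 - s^2) = s (1 - s theta), that is theta = s.  Conversely
theta = s forces |s| < 1, so v <> 0. *)
Lemma geodesic_star p u tau : ip u u = 1 -> halfspace p -> u.1.2 = 0 ->
  focal_star J p u (geodesic J p u tau) <-> tanh (tau / 2) = u.2.
Proof.
move=> hu p0 z0; have th1 := tanh_half_itv tau.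
have q0 := halfspace_geodesic tau p0 hu.
have s1 := shift_gt0 hu th1; have c0 := lt0r_neq0 (chi_gt0 hu th1).
have nv := sqnorm_v hu; rewrite /sqnorm_za z0 dot0l addr0 in nv.
pose a := Num.sqrt p.2 * (2 * tanh (tau / 2) / (1 - u.2 * tanh (tau / 2))).
have -> : focal_star J p u (geodesic J p u tau) <->
    u.1.1 != 0 /\ a * dot u.1.1 u.1.1 = 2 * u.2 * Num.sqrt p.2.
  have E1 : (geodesic J p u tau).1.1 - p.1.1 = a *: u.1.1.
    rewrite /geodesic /prolong /= z0 linear0 mulmx0 scaler0 addr0 addrAC subrr add0r.
    rewrite scalerA /a; congr (_ * _ *: _); rewrite /chi z0 enorm_sqr dot0l mul0r addr0.
    by field; rewrite lt0r_neq0.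
  rewrite /focal_star /= E1 bracketZl bracketvv // scaler0 dotZl.
  by split=> [[_ ? _ ?]|[? ?]].
rewrite /a -dot_gt0 nv; move: s1 th1; set th := tanh _ => s1 th1.
have sp0 : 0 < Num.sqrt p.2 by rewrite sqrtr_gt0.
split=> [[_ H]|ths]; last first.
  rewrite ths in s1 th1 *; split; first by nra.
  by field; rewrite lt0r_neq0.
have : Num.sqrt p.2 * (2 * (th - u.2) / (1 - u.2 * th)) = 0.
  have -> : 2 * (th - u.2) / (1 - u.2 * th) =
      (2 * th / (1 - u.2 * th)) * (1 - u.2 ^+ 2) - 2 * u.2.
    by field; rewrite lt0r_neq0.
  by rewrite mulrBr mulrA H; ring.
move/eqP; rewrite !mulf_eq0 invr_eq0 pnatr_eq0 (gt_eqF sp0) (gt_eqF s1) /= orbF.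
by rewrite subr_eq0 => /eqP.
Qed.

End Velocity.

Theorem corollary9p3 (R : realType) (n m : nat)
    (J : {linear 'rV[R]_m -> 'M[R]_n}) (hJ : clifford_rep J)
    (p u : amb R n m) (hp : halfspace p) (hu : ip u u = 1) (tau : R) :
  exists! F : set (amb R n m),
    focal_variety J p u F /\ meets_orthogonally J (geodesic J p u) tau F.
Proof.
have th1 := tanh_half_itv tau; have q0 := halfspace_geodesic J tau hp hu.
have s1 := shift_gt0 hu th1; have c0 := chi_gt0 hu th1.
have [l l0 EC] := geodesic_velocity J p tau hu.
have [C1 oC C2] : [/\ (derive1 (geodesic J p u) tau).1.1 =
      (l * Num.sqrt p.2) *: (prolong0_dir J u (tanh (tau / 2))).1.1,
    omega J (geodesic J p u tau) (derive1 (geodesic J p u) tau) =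
      (l * (p.2 * (1 - tanh (tau / 2) ^+ 2))) *: u.1.2 &
    (derive1 (geodesic J p u) tau).2 =
      l * (p.2 * (u.2 * (1 + tanh (tau / 2) ^+ 2) - (1 + sqnorm_za u) * tanh (tau / 2)))].
  rewrite EC; split=> //=; first by rewrite scalerA.
  by rewrite omegaZ omega_ltrans // omega_prolong0 ?lt0r_neq0 // !scalerA mulrA.
rewrite /meets_orthogonally.
move: (geodesic_star hJ tau hu hp) C1 oC C2 q0 => {EC}.
move: (geodesic J p u tau) (derive1 (geodesic J p u) tau) => q C star C1 oC C2 q0.
set th := tanh _ in th1 s1 c0 star C1 oC C2.
have th2 : 0 < 1 - th ^+ 2 by nra.
(* Away from the degenerate velocity, the unique F_x0 answers the question once
   F_circledast is known to miss q. *)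
have generic : C.2 ^+ 2 + dot (omega J q C) (omega J q C) != 0 ->
    (u.1.2 = 0 -> ~ focal_star J p u q) ->
    exists! F, focal_variety J p u F /\
      (F q /\ forall X, tangent F q X -> metric J q C X = 0).
  move=> C0 nstar; have [x0 [[Fq orth] uniq]] := exists_unique_focal hJ q0 C0.
  exists (focal J x0); split=> [|F [[[x1 [_ ->]]|[z0 ->]] [Fq1 orth1]]].
  - split=> //; left; exists x0; split=> //.
    have [_ et] := focal_coords Fq.
    by rewrite /halfspace /= in q0; have := dot_ge0 (q.1.1 - x0.1.1); lra.
  - by rewrite (uniq x1).
  - by case: (nstar z0).
have [z0|zN0] := eqVneq u.1.2 0; last first.
  apply: generic => [|z0]; last by rewrite z0 eqxx in zN0.
  rewrite oC dotZl dotZr lt0r_neq0 // ltr_wpDl ?sqr_ge0 //.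
  by rewrite !mulr_gt0 // dot_gt0.
have /star sP := z0.
have kE : sqnorm_za u = u.2 ^+ 2 by rewrite /sqnorm_za z0 dot0l addr0.
have oC0 : omega J q C = 0 by rewrite oC z0 scaler0.
have [ths|thNs] := eqVneq th u.2; last first.
  apply: generic => [|_ /sP ths]; last by rewrite ths eqxx in thNs.
  rewrite oC0 dot0l addr0 sqrf_eq0 C2 kE.
  have -> : u.2 * (1 + th ^+ 2) - (1 + u.2 ^+ 2) * th = (u.2 - th) * (1 - u.2 * th) by ring.
  by rewrite !mulf_eq0 (gt_eqF l0) (gt_eqF hp) (gt_eqF s1) subr_eq0 eq_sym (negPf thNs).
have C20 : C.2 = 0 by rewrite C2 kE ths; ring.
have C1E : C.1.1 = (l * Num.sqrt p.2 * (1 - th ^+ 2) ^+ 2) *: u.1.1.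
  rewrite C1 /= z0 linear0 mulmx0 scaler0 addr0 scalerA kE -ths; congr (_ *: _); ring.
have vN0 : u.1.1 != 0 by case: (sP.2 ths).
exists (focal_star J p u); split=> [|F [[[x1 [_ ->]]|[_ ->]] [Fq1 orth1]] //].
  split; first by right.
  split; first exact/sP.
  by apply: (star_orthogonal (sP.2 ths) C20 oC0); eexists; exact: C1E.
case: (no_focal_v_velocity hJ C20 oC0 _ Fq1 orth1).
by rewrite C1E scaler_eq0 negb_or vN0 andbT lt0r_neq0 // !mulr_gt0 ?sqrtr_gt0 ?exprn_gt0.
Qed.
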